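(* Let $(d_k:k\geq1)$ and $(N_k:k\geq1)$ be sequences of positive integers. Suppose there are $\alpha>0$, $\beta>0$ and an integer $s\geq0$ such that, for all $k$, $d_{k+1}\geq(1+\alpha)d_k$ and $d_k\leq\beta N_{k+s}$. Then there is a constant $c>0$, depending only on $s$, $\alpha$ and $\sup_k d_k/N_{k+s}$, such that for every sequence $(f_k:k\geq1)$ with $f_k\in H^1_{d_k}(\mathbb{D})$, $$\big\|(\mathbb{E}^*_{N_k}|f_k|)_{k=1}^\infty\big\|_{\mathrm{ind}}\leq c\,\big\|(f_k)_{k=1}^\infty\big\|_{L^1(\ell^2)}.$$
   Context: $\mathbb{T}$ is identified with $[0,1)$, with addition modulo $1$ and Lebesgue measure $\mu$. Define $H^1_n(\mathbb{D})=\mathrm{span}\{e^{2\pi ijt}:0\leq j\leq n\}$. For $x_0\in\mathbb{T}$ set $\tau_{x_0}f(x)=f(x-x_0)$, and set $\mathbb{E}^*_N=\frac1N\sum_{j=0}^{N-1}\tau_{j/N}$. For a sequence $(g_k)$ of functions on $\mathbb{T}$, define $$\|(g_k)\|_{L^1(\ell^2)}=\int_{\mathbb{T}}\Big(\sum_k|g_k(t)|^2\Big)^{1/2}dt$$ and $$\|(g_k)\|_{\mathrm{ind}}=\int_{\mathbb{T}^\infty}\Big(\sum_k|g_k(\omega_k)|^2\Big)^{1/2}d\mu^{\otimes\infty}(\omega).$$ In the second norm each $g_k$ is evaluated at an independent coordinate $\omega_k$. *)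

(* Defs.v *)
From HB Require Import structures.
From mathcomp Require Import all_boot all_order all_algebra.
From mathcomp Require Import complex.
From mathcomp Require Import all_classical all_reals all_analysis.
Set Implicit Arguments. Unset Strict Implicit. Unset Printing Implicit Defensive.
Import Order.TTheory GRing.Theory Num.Theory.
Import numFieldNormedType.Exports.
Local Open Scope classical_set_scope.
Local Open Scope ring_scope.

(* The circle T is [0,1) with addition mod 1 and
   Lebesgue measure; functions on T are modelled as functions R -> C whose
   values on [0,1) are the relevant ones. *)

Section Defs.
Variable R : realType.

Definition frac (x : R) : R := x - (Num.floor x)%:~R.

Definition expi (t : R) : R[i] := (cos t +i* sin t)%C.

Definition cmod (z : R[i]) : R := Normc.normc z.

Definition inH1 (n : nat) (f : R -> R[i]) : Prop :=
  exists a : nat -> R[i], forall t : R, 0 <= t < 1 ->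
    f t = \sum_(j < n.+1) a j * expi (2 * pi * j%:R * t).

Definition tau (T : Type) (x0 : R) (f : R -> T) : R -> T :=
  fun x => f (frac (x - x0)).

Definition Estar (N : nat) (g : R -> R) : R -> R :=
  fun x => N%:R^-1 * \sum_(j < N) tau (j%:R / N%:R) g x.

Definition intT (F : R -> \bar R) : \bar R :=
  (\int[lebesgue_measure]_(x in `[0%R, 1%R[) F x)%E.

(* iterated integral over T^n of F, integrating coordinates 0..n-1 of
   omega : nat -> R (the other coordinates are set to 0) *)
Fixpoint iintT (n : nat) (F : (nat -> R) -> \bar R) : \bar R :=
  match n with
  | 0 => F (fun _ => 0)
  | m.+1 => intT (fun x => iintT m (fun w => F (fun j => if j == m then x else w j)))
  end.

Definition L1l2_norm (g : nat -> R -> R) : \bar R :=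
  intT (fun t => poweR (\sum_(0 <= k <oo) ((g k t) ^+ 2)%:E)%E (2^-1)).

(* || (g_k) ||_ind = int_{T^oo} (sum_k |g_k(omega_k)|^2)^{1/2} d mu^{oo}(omega),
   computed (monotone convergence) as the supremum over n of the integrals over
   T^n of the truncated square functions (sum_{k<n} |g_k(omega_k)|^2)^{1/2}. *)
Definition ind_norm (g : nat -> R -> R) : \bar R :=
  ereal_sup [set iintT n (fun w => (Num.sqrt (\sum_(k < n) (g k (w k)) ^+ 2))%:E)
            | n in [set: nat]].

End Defs.

(* Main.v *)
Require Import Defs.
From HB Require Import structures.
From mathcomp Require Import all_boot all_order all_algebra.
From mathcomp Require Import complex.
From mathcomp Require Import all_classical all_reals all_analysis.
From mathcomp Require Import ring lra zify.
Import Order.TTheory GRing.Theory Num.Theory.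
Import numFieldNormedType.Exports.
Local Open Scope ring_scope.

(** Let [h_k = |f_k|] and [T_m = (sum_(i < m) h_i^2)^(1/2)]. The function
    [excess a t = sqrt (a^2 + t^2) - a] is nonincreasing in [a >= 0] and jointly
    convex. By the first property, for any constant [l >= 0],
    [(sum_k g_k^2)^(1/2) <= l + sum_k excess l g_k] pointwise, so that the
    integral over independent coordinates reduces to one-dimensional ones.
    By the second, if all averages of [T_(k-s)] over translates of the grid of
    mesh [1/N_k] are at most [l], then
    [excess l (E*_(N_k) h_k) <= E*_(N_k) (excess T_(k-s) h_k)]; the integral of
    the right-hand side is at most [int T_(k+1) - int T_(k-s)], which telescopes
    to [(s+1) int T_n].

    The admissible [l = C int T_n] comes from a Marcinkiewicz-Zygmund inequality
    for l^2-valued polynomials of degree [d_(k-s) <= beta N_k]: on a grid of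
    [L >= 2d] points, convolution with a kernel of de la Vallee-Poussin type
    reproduces such polynomials exactly, and Parseval on the grid bounds the
    kernel. *)

(** * Finite Euclidean norms and Minkowski's inequality *)

Definition l2 {R : realType} (n : nat) (b : nat -> R) : R :=
  Num.sqrt (\sum_(k < n) b k ^+ 2).

Lemma l2_ge0 {R : realType} n (b : nat -> R) : 0 <= l2 n b.
Proof. exact: sqrtr_ge0. Qed.

Lemma sqr_l2 {R : realType} n (b : nat -> R) : l2 n b ^+ 2 = \sum_(k < n) b k ^+ 2.
Proof. by rewrite sqr_sqrtr // sumr_ge0 // => k _; exact: sqr_ge0. Qed.

Lemma l2S {R : realType} n (b : nat -> R) :
  l2 n.+1 b = Num.sqrt (l2 n b ^+ 2 + b n ^+ 2).
Proof. by rewrite sqr_l2 /l2 big_ord_recr. Qed.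

Lemma minkowski2 {R : realType} (a b c d : R) :
  Num.sqrt ((a + c) ^+ 2 + (b + d) ^+ 2) <=
  Num.sqrt (a ^+ 2 + b ^+ 2) + Num.sqrt (c ^+ 2 + d ^+ 2).
Proof. exact: (le_normcD (a +i* b)%C (c +i* d)%C). Qed.

Lemma ler_sqrtD2 {R : realType} (a b c d : R) : 0 <= a <= c -> 0 <= b <= d ->
  Num.sqrt (a ^+ 2 + b ^+ 2) <= Num.sqrt (c ^+ 2 + d ^+ 2).
Proof.
move=> /andP[a0 ac] /andP[b0 bd]; apply: ler_wsqrtr.
have [c0 d0] : 0 <= c /\ 0 <= d by split; [exact: le_trans ac|exact: le_trans bd].
by apply: lerD; apply: lerXn2r; rewrite ?nnegrE.
Qed.

Lemma l2_le {R : realType} n (b c : nat -> R) :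
  (forall k, (k < n)%N -> 0 <= b k <= c k) -> l2 n b <= l2 n c.
Proof.
move=> bc; apply: ler_wsqrtr; apply: ler_sum => k _.
have /andP[b0 bk] := bc k (ltn_ord k).
by apply: lerXn2r; rewrite ?nnegrE //; apply: le_trans bk.
Qed.

Lemma l2_triangle {R : realType} n (b c : nat -> R) :
  (forall k, (k < n)%N -> 0 <= b k) -> (forall k, (k < n)%N -> 0 <= c k) ->
  l2 n (fun k => b k + c k) <= l2 n b + l2 n c.
Proof.
elim: n => [|n IH] b0 c0; first by rewrite /l2 !big_ord0 sqrtr0 addr0.
rewrite !l2S; apply: le_trans (minkowski2 _ _ _ _).
apply: ler_sqrtD2; first by rewrite l2_ge0 IH // => k kn; [apply: b0|apply: c0]; lia.
by rewrite lexx andbT addr_ge0 ?b0 ?c0.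
Qed.

Lemma l2Z {R : realType} n (w : R) (b : nat -> R) : 0 <= w ->
  l2 n (fun k => w * b k) = w * l2 n b.
Proof.
move=> w0; rewrite /l2; under eq_bigr do rewrite exprMn.
by rewrite -big_distrr /= sqrtrM ?sqr_ge0 // sqrtr_sqr ger0_norm.
Qed.

(** Induction from the triangle inequality and homogeneity. It serves twice: with kernel values as
    weights it makes sampling vector-valued, and with [n = 2] and equal weights it is the joint
    convexity of the planar norm behind [excess_gridavg]. *)
Lemma l2_sum {R : realType} n (I : Type) (r : seq I) (w : I -> R) (b : I -> nat -> R) :
  (forall i, 0 <= w i) -> (forall i k, 0 <= b i k) ->
  l2 n (fun k => \sum_(i <- r) w i * b i k) <= \sum_(i <- r) w i * l2 n (b i).
Proof.
move=> w0 b0; elim: r => [|i r IH].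
  by rewrite big_nil /l2; under eq_bigr do rewrite big_nil expr0n; rewrite sumr_const mul0rn sqrtr0.
under eq_fun do rewrite big_cons; rewrite big_cons.
apply: le_trans (@l2_triangle _ n (fun k => w i * b i k) _ _ _) _.
- by move=> k _; rewrite mulr_ge0.
- by move=> k _; rewrite sumr_ge0 // => j _; rewrite mulr_ge0.
by rewrite l2Z // lerD2l.
Qed.

(** * Exponentials and their orthogonality on uniform grids *)

Definition mode {R : realType} (r : R) : R[i] := expi (2 * pi * r).
Arguments mode : simpl never.

Section Mode.
Context {R : realType}.
Implicit Types x y z r : R.

Lemma modeD x y : mode (x + y) = mode x * mode y.
Proof.
rewrite /mode mulrDr /expi cosD sinD; apply/eqP; rewrite eq_complex /=.
by rewrite eqxx /= addrC.
Qed.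

Lemma modeN x : mode (- x) = (mode x)^*%C.
Proof. by rewrite /mode mulrN /expi cosN sinN. Qed.

Lemma mode0 : mode (0 : R) = 1.
Proof. by rewrite /mode mulr0 /expi cos0 sin0. Qed.

Lemma mode1 : mode (1 : R) = 1.
Proof. by rewrite /mode mulr1 mulr_natl /expi cos2pi sin2pi. Qed.

Lemma mode_nat n : mode (n%:R : R) = 1.
Proof. by elim: n => [|n IH]; rewrite ?mode0 // -natr1 modeD IH mode1 mulr1. Qed.

Lemma mode_natN n : mode (- n%:R : R) = 1.
Proof. by rewrite modeN mode_nat conjc1. Qed.

Lemma modeXn r n : mode r ^+ n = mode (r * n%:R).
Proof.
elim: n => [|n IH]; first by rewrite mulr0 mode0.
by rewrite exprSr IH -modeD -natr1 mulrDr mulr1.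
Qed.

(** The real part is [1 - 2 sin^2 (pi r)], and the sine is positive on [(0, pi)]. *)
Lemma mode_neq1 r : 0 < r < 1 -> mode r != 1.
Proof.
move=> /andP[r0 r1]; rewrite eq_complex /= negb_and; apply/orP; left.
have s0 : 0 < sin (pi * r).
  apply: sin_gt0_pi; rewrite mulr_gt0 ?pi_gt0 //=.
  by rewrite gtr_pMr ?pi_gt0.
have -> : 2 * pi * r = (pi * r) *+ 2 by rewrite mulr2n; ring.
rewrite cos_mulr2n cos2sin2; apply/eqP => h.
have : 0 < sin (pi * r) ^+ 2 by rewrite exprn_gt0.
by rewrite mulr2n in h; lra.
Qed.

(** For [a] different from [b] the sum is geometric; its ratio [mode u] is an [L]-th root of unity,
    and it is not 1 because [0 < |a - b| < L]. *)
Lemma sum_mode_grid (L a b : nat) z : (a < L)%N -> (b < L)%N ->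
  \sum_(j < L) mode (a%:R * (z - j%:R / L%:R)) * (mode (b%:R * (z - j%:R / L%:R)))^*%C
  = (if a == b then L%:R else 0).
Proof.
move=> aL bL; have L0 : (L%:R : R) != 0 by rewrite pnatr_eq0; lia.
under eq_bigr do rewrite -modeN -modeD.
case: eqVneq => [->|ab].
  under eq_bigr do rewrite addrN mode0.
  by rewrite sumr_const card_ord.
pose u : R := (b%:R - a%:R) / L%:R.
have E (j : 'I_L) : true -> mode (a%:R * (z - j%:R / L%:R) + - (b%:R * (z - j%:R / L%:R))) =
    mode ((a%:R - b%:R) * z) * mode u ^+ j.
  by move=> _; rewrite modeXn -modeD; congr mode; rewrite /u; field.
rewrite (eq_bigr _ E) -big_distrr /=.
suff -> : \sum_(i < L) mode u ^+ i = 0 by rewrite mulr0.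
have uL : mode u ^+ L = 1.
  rewrite modeXn /u divfK //; have [ba|ba] := leqP a b.
    by rewrite -natrB // mode_nat.
  by rewrite -opprB -natrB ?mode_natN // ltnW.
have L1 : (0 < L)%N by lia.
have LR : 0 < (L%:R : R) by rewrite ltr0n.
(* [u] lies in [(-1, 1)] with the sign of [b - a]; a negative [u] is brought into the range of
   [mode_neq1] by conjugation. *)
have u1 : mode u != 1.
  have [ba|ba] := ltnP a b.
    apply: mode_neq1; rewrite /u -natrB ?(ltnW ba) // divr_gt0 ?ltr0n ?subn_gt0 //=.
    by rewrite ltr_pdivrMr // mul1r ltr_nat; lia.
  have {}ba : (b < a)%N by lia.
  apply/eqP => hu; have /eqP : mode (- u) = 1 by rewrite modeN hu conjc1.
  apply/negP/mode_neq1; rewrite /u -mulNr opprB -natrB ?(ltnW ba) // divr_gt0 ?ltr0n ?subn_gt0 //=.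
  by rewrite ltr_pdivrMr // mul1r ltr_nat; lia.
have := subrX1 (mode u) L; rewrite uL subrr => /esym/eqP.
by rewrite mulf_eq0 subr_eq0 (negbTE u1) /= => /eqP.
Qed.

End Mode.

(** * The complex modulus *)

Section Modulus.
Context {R : realType}.
Implicit Types z w : R[i].

Lemma cmod_ge0 z : 0 <= cmod z.
Proof. by case: z => a b; exact: sqrtr_ge0. Qed.

Lemma cmodM z w : cmod (z * w) = cmod z * cmod w.
Proof. exact: Normc.normcM. Qed.

Lemma cmodJ z : cmod z^*%C = cmod z.
Proof. by case: z => a b; rewrite /cmod /= sqrrN. Qed.

Lemma cmod_sum (I : Type) (r : seq I) (F : I -> R[i]) :
  cmod (\sum_(i <- r) F i) <= \sum_(i <- r) cmod (F i).
Proof.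
elim/big_rec2: _ => [|i y x _ yx]; first by rewrite /cmod Normc.normc0.
by apply: le_trans (le_normcD _ _) _; rewrite lerD2l.
Qed.

Lemma cmod_real (x : R) : 0 <= x -> cmod (x%:C)%C = x.
Proof. by move=> x0; rewrite /cmod /= expr0n addr0 sqrtr_sqr ger0_norm. Qed.

Lemma sqr_cmod z : ((cmod z ^+ 2)%:C)%C = z * z^*%C.
Proof.
case: z => a b; rewrite /cmod /= sqr_sqrtr ?addr_ge0 ?sqr_ge0 //.
by simpc; rewrite -!expr2; apply/eqP; rewrite eq_complex /= eqxx /=; apply/eqP; ring.
Qed.

End Modulus.

(** * Trigonometric polynomials, the reproducing kernel and sampling on grids *)

Definition trig_poly {R : realType} (d : nat) (a : nat -> R[i]) (t : R) : R[i] :=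
  \sum_(j < d.+1) a j * mode (j%:R * t).

Definition dirichlet {R : realType} (M : nat) (t : R) : R[i] :=
  \sum_(j < M) mode (j%:R * t).

(* The Fourier coefficients at 0, ..., d are all equal to 1, because each of the
   d frequencies of the first factor can be completed in exactly one way. *)
Definition vp_kernel {R : realType} (d : nat) (t : R) : R[i] :=
  d%:R^-1 * ((dirichlet d t)^*%C * dirichlet (2 * d) t).

Definition gridavg {R : realType} (N : nat) (g : R -> R) (x : R) : R :=
  N%:R^-1 * \sum_(j < N) g (x - j%:R / N%:R).

Section Sampling.
Context {R : realType}.
Implicit Types x y z : R.

(** Parseval on the grid: expand the square as a double sum over frequencies. All of them are below
    [L], so only the [M] diagonal pairs survive the sum over the grid. *)
Lemma gridavg_dirichlet (L M : nat) z : (0 < L)%N -> (M <= L)%N ->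
  gridavg L (fun t => cmod (dirichlet M t) ^+ 2) z = M%:R.
Proof.
move=> L0 ML; have Ln0 : (L%:R : R) != 0 by rewrite pnatr_eq0; lia.
apply: (mulfI Ln0); rewrite /gridavg mulVKf //.
apply: (fmorph_inj (real_complex R)).
rewrite raddf_sum rmorphM !rmorph_nat.
transitivity (\sum_(j < L) \sum_(a < M) \sum_(b < M)
    mode (a%:R * (z - j%:R / L%:R)) * (mode (b%:R * (z - j%:R / L%:R)))^*%C).
  apply: eq_bigr => j _; apply: (etrans (sqr_cmod _)).
  rewrite /dirichlet rmorph_sum mulr_suml.
  by apply: eq_bigr => a _; rewrite mulr_sumr.
rewrite exchange_big /=.
under eq_bigr => a _.
  rewrite exchange_big /=.
  under eq_bigr => b _.
    rewrite sum_mode_grid; [|exact: leq_trans (ltn_ord _) ML|exact: leq_trans (ltn_ord _) ML].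
    over.
  rewrite -big_mkcond (big_pred1 a); last by move=> b; rewrite /= eq_sym.
  over.
by rewrite sumr_const card_ord mulr_natr.
Qed.

(** The kernel is a sum over pairs [(a, b)] of frequencies [b - a]. The grid sum keeps only
    [b = l + a], which is below [2 * d] because [a < d] and [l <= d]; the [d] choices of [a] cancel
    the factor [1 / d]. The condition [2 * d <= L] excludes aliasing, and the offset [y] of the grid
    is arbitrary. *)
Lemma mode_reproducing (L d l : nat) x y : (0 < d)%N -> (2 * d <= L)%N -> (l <= d)%N ->
  mode (l%:R * x) = L%:R^-1 * \sum_(i < L) mode (l%:R * (y - i%:R / L%:R)) *
    vp_kernel d (x - (y - i%:R / L%:R)).
Proof.
move=> d0 dL ld.
have Ln0 : (L%:R : R[i]) != 0 by rewrite pnatr_eq0; lia.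
have dn0 : (d%:R : R[i]) != 0 by rewrite pnatr_eq0; lia.
pose Y (i : nat) : R := y - i%:R / L%:R.
apply: (mulfI Ln0); rewrite mulVKf //.
have E (i : 'I_L) : true -> mode (l%:R * (y - i%:R / L%:R)) *
    vp_kernel d (x - (y - i%:R / L%:R)) =
  \sum_(a < d) \sum_(b < 2 * d) (d%:R^-1 * mode (b%:R * x - a%:R * x)) *
     (mode ((l + a)%:R * Y i) * (mode (b%:R * Y i))^*%C).
  move=> _; rewrite -/(Y i) /vp_kernel /dirichlet rmorph_sum mulr_suml !mulr_sumr.
  apply: eq_bigr => a _; rewrite !mulr_sumr; apply: eq_bigr => b _.
  have -> : (@conjc R : {rmorphism _ -> _}) (mode (a%:R * (x - Y i))) = mode (- (a%:R * (x - Y i))) by rewrite modeN.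
  rewrite -!modeN mulrCA -!modeD -mulrA -!modeD; congr (_ * mode _).
  by rewrite natrD; ring.
rewrite (eq_bigr _ E) exchange_big /=.
have E2 (a : 'I_d) : true -> \sum_(i < L) \sum_(b < 2 * d)
    (d%:R^-1 * mode (b%:R * x - a%:R * x)) *
     (mode ((l + a)%:R * Y i) * (mode (b%:R * Y i))^*%C) = d%:R^-1 * mode (l%:R * x) * L%:R.
  move=> _; have ad := ltn_ord a; rewrite exchange_big /=.
  have lad : (l + a < 2 * d)%N by lia.
  rewrite (bigD1 (Ordinal lad) isT) [X in _ + X = _]big1 ?addr0.
    rewrite -mulr_sumr sum_mode_grid ?eqxx; [|exact: leq_trans lad dL|exact: leq_trans lad dL].
    by congr (_ * mode _ * _); rewrite natrD; ring.
  move=> b /eqP bla; have bd := ltn_ord b.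
  rewrite -mulr_sumr sum_mode_grid; [|lia|lia].
  case: eqP => [e|_]; last by rewrite mulr0.
  by case: bla; apply: val_inj.
rewrite (eq_bigr _ E2) sumr_const card_ord -[RHS]mulr_natr.
by field.
Qed.

Lemma trig_poly_reproducing (L d : nat) a x y : (0 < d)%N -> (2 * d <= L)%N ->
  trig_poly d a x = L%:R^-1 * \sum_(i < L) trig_poly d a (y - i%:R / L%:R) *
    vp_kernel d (x - (y - i%:R / L%:R)).
Proof.
move=> d0 dL; rewrite /trig_poly.
under [in RHS]eq_bigr do rewrite mulr_suml.
rewrite exchange_big mulr_sumr; apply: eq_bigr => j _.
rewrite (mode_reproducing L d j x y) //; last by have := ltn_ord j; lia.
rewrite mulrCA mulr_sumr; congr (_ * _); apply: eq_bigr => i _.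
by rewrite mulrA.
Qed.

Lemma gridavg_le N (g h : R -> R) x : (forall t, g t <= h t) -> gridavg N g x <= gridavg N h x.
Proof.
by move=> gh; rewrite /gridavg ler_wpM2l ?invr_ge0 ?ler0n // ler_sum.
Qed.

(** By the arithmetic-geometric mean inequality the product of the two Dirichlet kernels is at most
    half the sum of their squares, and grid Parseval gives [(d + 2 d) / (2 d) = 3 / 2]. *)
Lemma gridavg_kernel (L d : nat) z : (0 < d)%N -> (2 * d <= L)%N ->
  gridavg L (fun t => cmod (vp_kernel d t)) z <= 3 / 2.
Proof.
move=> d0 dL; have dR : 0 < (d%:R : R) by rewrite ltr0n.
have h (t : R) : cmod (vp_kernel d t) <=
   (2 * d%:R)^-1 * cmod (dirichlet d t) ^+ 2 + (2 * d%:R)^-1 * cmod (dirichlet (2 * d) t) ^+ 2.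
  have -> : (vp_kernel d t) = (d%:R^-1)%:C%C * ((dirichlet d t)^*%C * dirichlet (2 * d) t).
    by rewrite /vp_kernel fmorphV rmorph_nat.
  rewrite !cmodM cmodJ cmod_real ?invr_ge0 ?ler0n // invfM -mulrDr.
  rewrite [2^-1 * _]mulrC -mulrA ler_pM2l ?invr_gt0 //.
  set a := cmod _; set b := cmod _; have := sqr_ge0 (a - b); nra.
apply: le_trans (gridavg_le _ _ _ _ h) _.
have -> : gridavg L (fun t => (2 * d%:R)^-1 * cmod (dirichlet d t) ^+ 2 +
     (2 * d%:R)^-1 * cmod (dirichlet (2 * d) t) ^+ 2) z =
  (2 * d%:R)^-1 * gridavg L (fun t => cmod (dirichlet d t) ^+ 2) z +
  (2 * d%:R)^-1 * gridavg L (fun t => cmod (dirichlet (2 * d) t) ^+ 2) z.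
  by rewrite /gridavg big_split /= -!mulr_sumr; ring.
rewrite !gridavg_dirichlet; [|lia|lia|lia|lia].
by rewrite natrM le_eqVlt; apply/orP; left; apply/eqP; field; rewrite gt_eqF.
Qed.

(** Any two translates of the grid give comparable averages. Each value on the grid of [x] is
    reproduced from the grid of [y]; Minkowski moves the norm inside, and after exchanging the sums
    the weight of each point of the grid of [y] is a grid average of the kernel. *)
Lemma gridavg_sampling (L d n : nat) (a : nat -> nat -> R[i]) x y :
  (0 < d)%N -> (2 * d <= L)%N ->
  gridavg L (fun t => l2 n (fun k => cmod (trig_poly d (a k) t))) x <=
  3 / 2 * gridavg L (fun t => l2 n (fun k => cmod (trig_poly d (a k) t))) y.
Proof.
move=> d0 dL; set T := (fun t : R => l2 _ _); pose Y (i : 'I_L) : R := y - i%:R / L%:R.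
have Li : 0 <= (L%:R^-1 : R) by rewrite invr_ge0 ler0n.
have TL (u : R) : T u <= \sum_(i < L) (L%:R^-1 * cmod (vp_kernel d (u - Y i))) * T (Y i).
  apply: (@le_trans _ _ (l2 n (fun k => \sum_(i < L)
     (L%:R^-1 * cmod (vp_kernel d (u - Y i))) * cmod (trig_poly d (a k) (Y i))))).
    apply: l2_le => k _; rewrite cmod_ge0 /= (trig_poly_reproducing L d (a k) u y) //.
    have -> : (L%:R^-1 : R[i]) = (L%:R^-1)%:C%C by rewrite fmorphV rmorph_nat.
    rewrite cmodM cmod_real //.
    under [leRHS]eq_bigr do rewrite -mulrA.
    rewrite -mulr_sumr ler_wpM2l // (le_trans (cmod_sum _ _ _)) //.
    by apply: ler_sum => i _; rewrite cmodM mulrC.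
  by apply: l2_sum => [i|i k]; rewrite ?mulr_ge0 ?cmod_ge0.
apply: le_trans (gridavg_le _ _ _ _ TL) _.
rewrite {1}/gridavg exchange_big /= mulr_sumr.
rewrite {1}/gridavg mulrCA mulr_sumr mulr_sumr; apply: ler_sum => i _.
rewrite -mulr_suml -mulr_sumr mulrA mulrA ler_wpM2r ?l2_ge0 //.
rewrite ler_wpM2l //.
apply: le_trans (gridavg_kernel L d (x - Y i) d0 dL).
rewrite /gridavg ler_wpM2l // le_eqVlt; apply/orP; left; apply/eqP.
by apply: eq_bigr => j _; congr (cmod (vp_kernel d _)); ring.
Qed.

(** The coarse grid is contained in the fine one; dropping the other nonnegative terms leaves only
    the change of normalization, a factor [m]. *)
Lemma gridavg_refine N m (g : R -> R) x : (forall t, 0 <= g t) -> (0 < N)%N -> (0 < m)%N ->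
  gridavg N g x <= m%:R * gridavg (m * N) g x.
Proof.
move=> g0 N0 m0.
have Nn : (N%:R : R) != 0 by rewrite pnatr_eq0; lia.
have mn : (m%:R : R) != 0 by rewrite pnatr_eq0; lia.
rewrite /gridavg {1}natrM invfM mulrA mulVKf // ler_wpM2l ?invr_ge0 ?ler0n //.
rewrite -(big_mkord xpredT (fun i => g (x - i%:R / (m * N)%:R))) mulnC big_nat_mul big_mkord.
(* The fine indices are grouped in blocks of length [m]; the first index [j * m] of a block is the
   coarse point [j]. *)
apply: ler_sum => j _; rewrite big_ltn; last by rewrite mulSn; lia.
have -> : (j * m)%:R / (N * m)%:R = j%:R / N%:R :> R by rewrite !natrM; field; rewrite Nn mn.
by rewrite lerDl sumr_ge0.
Qed.

End Sampling.

(** * Integration of continuous periodic functions over the circle *)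

Definition mean {R : realType} (G : R -> R) : R :=
  (\int[lebesgue_measure]_(x in `[0%R, 1%R[) G x).

Definition circle_continuous {R : realType} (G : R -> R) : Prop :=
  continuous G /\ forall x, G (x + 1) = G x.

Section Integral.
Context {R : realType}.
Implicit Types (G H : R -> R) (F : R -> \bar R).
Notation mu := (@lebesgue_measure R).

(* Measurability is not required: the integral of a nonnegative function is a
   supremum over the simple functions below it. *)
Lemma le_intT F F' : (forall x, 0 <= x < 1 -> (0 <= F x /\ F x <= F' x)%E) ->
  (intT F <= intT F')%E.
Proof.
move=> FF'; have F0 x : `[0, 1[%classic x -> (0 <= F x)%E.
  by rewrite /= in_itv => /FF'[].
have F'0 x : `[0, 1[%classic x -> (0 <= F' x)%E.
  by rewrite /= in_itv => /FF'[]; exact: le_trans.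
rewrite /intT !ge0_integralE //.
apply: le_ereal_sup => _ [h hF <-]; exists h => // x.
apply: le_trans (hF x) _; rewrite !patchE; case: ifPn => // /set_mem.
by rewrite /= in_itv => /FF'[].
Qed.

Lemma continuous_integrable G (a b : R) : continuous G ->
  mu.-integrable `[a, b] (EFin \o G).
Proof.
move=> cG; apply: continuous_compact_integrable; first exact: segment_compact.
exact: continuous_subspaceT.
Qed.

Lemma continuous_integrable01 G : continuous G -> mu.-integrable `[0, 1[ (EFin \o G).
Proof.
move=> /(continuous_integrable G 0 1); apply: integrableS => //.
by apply: subset_itvl; rewrite bnd_simp.
Qed.

Lemma intTE G : continuous G -> intT (EFin \o G) = (mean G)%:E.
Proof.
move=> cG; rewrite /mean /Rintegral fineK //.
exact: integrable_fin_num (continuous_integrable01 G cG).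
Qed.

Lemma mean_le G H : continuous G -> continuous H ->
  (forall x, G x <= H x) -> mean G <= mean H.
Proof.
by move=> cG cH GH; apply: le_Rintegral => //; exact: continuous_integrable01.
Qed.

Lemma meanD G H : continuous G -> continuous H -> mean (fun x => G x + H x) = mean G + mean H.
Proof. by move=> cG cH; apply: RintegralD => //; exact: continuous_integrable01. Qed.

Lemma meanZ c G : continuous G -> mean (fun x => c * G x) = c * mean G.
Proof. by move=> cG; apply: RintegralZl => //; exact: continuous_integrable01. Qed.

Lemma mean_cst c : mean (fun _ : R => c) = c.
Proof.
rewrite /mean Rintegral_cst //= lebesgue_measure_itv /= lte_fin ltr01.
by rewrite -EFinB /= subr0 mulr1.
Qed.

Lemma continuous_sumR (I : Type) (r : seq I) (G : I -> R -> R) :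
  (forall i, continuous (G i)) -> continuous (fun x => \sum_(i <- r) G i x).
Proof.
move=> cG; elim: r => [|i r IH].
  by under eq_fun do rewrite big_nil; move=> x; exact: cvg_cst.
under eq_fun do rewrite big_cons; move=> x; apply: cvgD; [exact: cG|exact: IH].
Qed.

Lemma mean_sum (I : Type) (r : seq I) (G : I -> R -> R) :
  (forall i, continuous (G i)) ->
  mean (fun x => \sum_(i <- r) G i x) = \sum_(i <- r) mean (G i).
Proof.
move=> cG; elim: r => [|i r IH].
  by under eq_fun do rewrite big_nil; rewrite big_nil mean_cst.
under eq_fun do rewrite big_cons; rewrite big_cons meanD ?IH //.
exact: continuous_sumR.
Qed.

Lemma Rintegral_shift G (a b c : R) : a <= b -> continuous G ->
  \int[mu]_(x in `[a, b]) G (x - c) = \int[mu]_(x in `[a - c, b - c]) G x.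
Proof.
move=> ab cG; rewrite /Rintegral; congr fine; apply/esym.
have dF (x : R) : is_derive x 1 (fun t : R => t - c) 1.
  by apply: is_derive_eq; rewrite subr0.
have F' : derive1 (fun t : R => t - c) = cst 1.
  by apply/funext => x; rewrite derive1E; exact: derive_val.
have cF : continuous (fun t : R => t - c).
  by move=> x; apply: cvgB; [exact: cvg_id|exact: cvg_cst].
rewrite (@integration_by_substitution_increasing R (fun t => t - c) G a b) //.
- by apply: eq_integral => x _; rewrite F' !fctE mulr1.
- by move=> x y _ _ xy; rewrite ltrD2r.
- by rewrite F' => x _; exact: cvg_cst.
- by rewrite F'; exact: is_cvg_cst.
- by rewrite F'; exact: is_cvg_cst.
- split => /=.
  + by move=> x _; exact: ex_derive.
  + by apply: cvg_at_right_filter; exact: cF.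
  + by apply: cvg_at_left_filter; exact: cF.
- exact: continuous_subspaceT.
Qed.

Lemma Rintegral_split G (a b c : R) : a <= c -> c <= b -> continuous G ->
  \int[mu]_(x in `[a, b]) G x = \int[mu]_(x in `[a, c]) G x + \int[mu]_(x in `[c, b]) G x.
Proof.
move=> ac cb cG; apply/eqP; rewrite addrC -subr_eq; apply/eqP.
rewrite (@Rintegral_itvB R G (BLeft a) (BRight b) c) ?bnd_simp //.
  apply: Rintegral_itv_obnd_cbnd.
  apply: integrableS (continuous_integrable G c b cG) => //.
  by apply: subset_itvr; rewrite bnd_simp.
exact: continuous_integrable.
Qed.

Lemma continuous_shiftR G (a : R) : continuous G -> continuous (fun x => G (x - a)).
Proof.
move=> cG x; apply: continuous_comp; last exact: cG.
by apply: cvgB; [exact: cvg_id|exact: cvg_cst].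
Qed.

(** The shifted integral runs over [[-a, 1 - a]]. Both periods contain [[0, 1 - a]], and periodicity
    carries the remaining piece [[-a, 0]] to [[1 - a, 1]]. *)
Lemma mean_shift G (a : R) : circle_continuous G -> 0 <= a <= 1 -> mean (fun x => G (x - a)) = mean G.
Proof.
move=> [cG pG] /andP[a0 a1].
have cF := continuous_shiftR G a cG.
rewrite /mean !Rintegral_itv_bndo_bndc; try exact: continuous_integrable01.
rewrite Rintegral_shift // sub0r.
rewrite (@Rintegral_split G (- a) (1 - a) 0) ?oppr_le0 ?subr_ge0 //.
rewrite (@Rintegral_split G 0 1 (1 - a)) ?subr_ge0 ?gerBl // addrC; congr (_ + _).
have := @Rintegral_shift G (1 - a) 1 1; rewrite gerBl => /(_ a0 cG).
have -> : 1 - a - 1 = - a by ring.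
rewrite subrr => <-.
by apply: eq_Rintegral => x _; rewrite -(pG (x - 1)) subrK.
Qed.

Lemma continuous_gridavg N G : continuous G -> continuous (gridavg N G).
Proof.
move=> cG x; rewrite /gridavg; apply: cvgM; first exact: cvg_cst.
by apply: continuous_sumR => j; exact: continuous_shiftR.
Qed.

Lemma mean_gridavg N G : circle_continuous G -> (0 < N)%N -> mean (gridavg N G) = mean G.
Proof.
move=> pG N0; have [cG _] := pG; have NR : 0 < (N%:R : R) by rewrite ltr0n.
rewrite /gridavg meanZ; last by apply: continuous_sumR => j; exact: continuous_shiftR.
rewrite mean_sum; last by move=> j; exact: continuous_shiftR.
rewrite (eq_bigr (fun _ => mean G)) => [|j _].
  by rewrite sumr_const card_ord -[mean G *+ N]mulr_natl mulKf // gt_eqF.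
apply: mean_shift => //; rewrite divr_ge0 ?ler0n //=.
by rewrite ler_pdivrMr // mul1r ler_nat ltnW.
Qed.

End Integral.

(** * The gain in Euclidean norm when a coordinate [t] is appended to a vector of norm [a] *)

Definition excess {R : realType} (a t : R) : R := Num.sqrt (a ^+ 2 + t ^+ 2) - a.

Section Excess.
Context {R : realType}.
Implicit Types a b t : R.

(** The triangle inequality for [(b, t) = (a, t) + (b - a, 0)]. *)
Lemma excess_antitone a b t : 0 <= a <= b -> excess b t <= excess a t.
Proof.
move=> /andP[a0 ab]; have := minkowski2 a t (b - a) 0.
rewrite addr0 [a + _]addrC subrK expr0n /= addr0 sqrtr_sqr ger0_norm ?subr_ge0 // /excess.
lra.
Qed.

(** Prepend [l] as an extra coordinate. The norm [X m] of the extended vector starts at [l] and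
    stays above it, so each new coordinate adds [excess (X m) (g m)], at most [excess l (g m)]. *)
Lemma l2_le_excess n (l : R) (g : nat -> R) : 0 <= l ->
  l2 n g <= l + \sum_(k < n) excess l (g k).
Proof.
move=> l0; pose X m := Num.sqrt (l ^+ 2 + \sum_(k < m) g k ^+ 2).
have S0 m : 0 <= \sum_(k < m) g k ^+ 2 by rewrite sumr_ge0 // => k _; exact: sqr_ge0.
have lX m : l <= X m.
  by rewrite -[leLHS]ger0_norm // -sqrtr_sqr ler_wsqrtr // lerDl.
apply: (@le_trans _ _ (X n)); first by rewrite ler_wsqrtr // lerDr sqr_ge0.
elim: n => [|n IH]; first by rewrite /X !big_ord0 !addr0 sqrtr_sqr ger0_norm.
have XS : X n.+1 = X n + excess (X n) (g n).
  rewrite /excess addrC subrK /X sqr_sqrtr ?addr_ge0 ?sqr_ge0 //.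
  by rewrite big_ord_recr /= addrA.
rewrite XS big_ord_recr [leRHS]addrA; apply: lerD => //=.
by apply: excess_antitone; rewrite l0 lX.
Qed.

(** Monotonicity replaces [l] by the smaller average of [T]; what remains is Jensen's inequality for
    the planar norm on the grid. *)
Lemma excess_gridavg N (T h : R -> R) l x : (forall t, 0 <= T t) -> (forall t, 0 <= h t) ->
  gridavg N T x <= l ->
  excess l (gridavg N h x) <= gridavg N (fun t => excess (T t) (h t)) x.
Proof.
move=> T0 h0 Tl; have Ni : 0 <= (N%:R^-1 : R) by rewrite invr_ge0 ler0n.
have A0 : 0 <= gridavg N T x by rewrite mulr_ge0 ?sumr_ge0.
apply: (@le_trans _ _ (excess (gridavg N T x) (gridavg N h x))).
  by rewrite excess_antitone // A0.
rewrite /excess /gridavg sumrB mulrBr lerD2r !mulr_sumr.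
pose y (j : 'I_N) : R := x - j%:R / N%:R.
pose b j k : R := if k == 0%N then T (y j) else h (y j).
apply: (@le_trans _ _ (\sum_(j < N) N%:R^-1 * l2 2 (b j))).
  apply: le_trans (@l2_sum R 2 _ _ (fun _ => N%:R^-1) b _ _) => //.
    by rewrite /l2 big_ord_recl big_ord1.
  by move=> j k; rewrite /b; case: ifP.
by apply: ler_sum => j _; rewrite /l2 big_ord_recl big_ord1.
Qed.

End Excess.

Section IteratedIntegral.
Context {R : realType}.

Lemma iintT_le n (F G : (nat -> R) -> \bar R) :
  (forall w, (forall j, 0 <= w j < 1) -> (0 <= F w /\ F w <= G w)%E) ->
  (0 <= iintT n F /\ iintT n F <= iintT n G)%E.
Proof.
elim: n F G => [|n IH] F G FG /=; first by apply: FG => j; rewrite lexx ltr01.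
have {}IH x : 0 <= x < 1 ->
   (0 <= iintT n (fun w => F (fun j => if j == n then x else w j)) /\
    iintT n (fun w => F (fun j => if j == n then x else w j)) <=
    iintT n (fun w => G (fun j => if j == n then x else w j)))%E.
  by move=> x01; apply: IH => w w01; apply: FG => j; case: ifP.
split; last exact: le_intT.
by apply: integral_ge0 => x; rewrite /= in_itv => /IH[].
Qed.

Lemma iintT_sum n c (psi : nat -> R -> R) : (forall k, continuous (psi k)) ->
  iintT n (fun w => (c + \sum_(k < n) psi k (w k))%:E) = (c + \sum_(k < n) mean (psi k))%:E.
Proof.
move=> cpsi; elim: n c => [|n IH] c /=; first by rewrite !big_ord0.
transitivity (intT (EFin \o (fun x => (c + \sum_(k < n) mean (psi k)) + psi n x))).
  apply: eq_integral => x _ /=.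
  rewrite -addrA [_ + psi n x]addrC addrA -IH; congr iintT; apply/funext => w.
  rewrite big_ord_recr /= eqxx [X in c + X]addrC addrA; congr (_ + _)%:E.
  by apply: eq_bigr => k _; rewrite ltn_eqF.
have cc (r : R) : continuous (fun _ : R => r) by move=> x; exact: cvg_cst.
rewrite intTE; last by move=> x; apply: cvgD; [exact: cc|exact: cpsi].
by rewrite meanD ?mean_cst // big_ord_recr /= addrA.
Qed.

End IteratedIntegral.

Lemma telescope_lag {R : realType} (u : nat -> R) (s n : nat) :
  (forall k, 0 <= u k) -> {homo u : i k / (i <= k)%N >-> i <= k} ->
  \sum_(k < n) (u k.+1 - u (k - s)%N) <= s.+1%:R * u n.
Proof.
move=> u0 uh.
have tel f : (forall k, (0 : R) <= f k) -> \sum_(k < n) (f k.+1 - f k) <= f n.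
  by move=> f0; rewrite -(big_mkord xpredT (fun k => f k.+1 - f k)) telescope_sumr // gerBl.
elim: s => [|s IH]; first by under eq_bigr do rewrite subn0; rewrite mul1r tel.
rewrite -natr1 mulrDl mul1r.
have E (k : 'I_n) : true -> u k.+1 - u (k - s.+1)%N =
  (u k.+1 - u (k - s)%N) + (u (k.+1 - s.+1)%N - u (k - s.+1)%N).
  by move=> _; rewrite subSS; ring.
rewrite (eq_bigr _ E) big_split /= lerD //.
apply: le_trans (tel (fun k => u (k - s.+1)%N) _) _ => //.
by apply: uh; lia.
Qed.

Section TrigPoly.
Context {R : realType}.

Lemma mode_int (m : int) : mode (m%:~R : R) = 1.
Proof. by case: m => n; rewrite ?NegzE ?mulrNz ?mode_natN // mode_nat. Qed.

Lemma trig_polyBint d (a : nat -> R[i]) (x : R) (m : int) :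
  trig_poly d a (x - m%:~R) = trig_poly d a x.
Proof.
rewrite /trig_poly; apply: eq_bigr => j _; rewrite mulrBr modeD.
have -> : - (j%:R * m%:~R) = (- (j%:Z * m))%:~R :> R by rewrite mulrNz intrM.
by rewrite mode_int mulr1.
Qed.

Lemma trig_poly_widen d d' (a : nat -> R[i]) (x : R) : (d <= d')%N ->
  trig_poly d' (fun j => if (j <= d)%N then a j else 0) x = trig_poly d a x.
Proof.
move=> dd; rewrite /trig_poly -(big_mkord xpredT (fun j => a j * mode (j%:R * x))).
rewrite -(big_mkord xpredT (fun j => (if (j <= d)%N then a j else 0) * mode (j%:R * x))).
rewrite (@big_cat_nat _ _ _ d.+1) //=.
rewrite [X in _ + X]big_nat_cond [X in _ + X]big1 ?addr0.
  by apply: eq_big_nat => j; rewrite ltnS => /= ->.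
move=> j; rewrite andbT => /andP[dj _].
by rewrite leqNgt dj mul0r.
Qed.

Lemma continuous_cmod_trig_poly d (a : nat -> R[i]) :
  continuous (fun t : R => cmod (trig_poly d a t)).
Proof.
pose P (f : R -> R[i]) := continuous (fun t => complex.Re (f t)) /\
                        continuous (fun t => complex.Im (f t)).
have PS (n : nat) : P (fun t => \sum_(j < n) a j * mode (j%:R * t)).
  elim: n => [|n [IHr IHi]].
    by split; under eq_fun do rewrite big_ord0; move=> x; exact: cvg_cst.
  have cl : continuous (fun t : R => 2 * pi * (n%:R * t)).
    move=> x; apply: cvgM; first exact: cvg_cst.
    by apply: cvgM; [exact: cvg_cst|exact: cvg_id].
  have cc : continuous (fun t : R => cos (2 * pi * (n%:R * t))).
    by move=> x; apply: continuous_comp; [exact: cl|exact: continuous_cos].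
  have cs : continuous (fun t : R => sin (2 * pi * (n%:R * t))).
    by move=> x; apply: continuous_comp; [exact: cl|exact: continuous_sin].
  have cZ (r : R) (f : R -> R) : continuous f -> continuous (fun t => r * f t).
    by move=> cf x; apply: cvgM; [exact: cvg_cst|exact: cf].
  case E : (a n) => [u v].
  have ReD (z w : R[i]) : complex.Re (z + w) = complex.Re z + complex.Re w by case: z; case: w.
  have ImD (z w : R[i]) : complex.Im (z + w) = complex.Im z + complex.Im w by case: z; case: w.
  split; under eq_fun do rewrite big_ord_recr /= E ?ReD ?ImD.
    move=> x; apply: cvgD; first exact: IHr.
    by rewrite /mode /=; apply: cvgB; apply: cZ.
  move=> x; apply: cvgD; first exact: IHi.
  by rewrite /mode /=; apply: cvgD; apply: cZ.
have [cr ci] := PS d.+1.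
have -> : (fun t : R => cmod (trig_poly d a t)) =
  (fun t => Num.sqrt (complex.Re (trig_poly d a t) ^+ 2 + complex.Im (trig_poly d a t) ^+ 2)).
  by apply/funext => t; case: (trig_poly d a t).
move=> x; apply: continuous_comp; last exact: sqrt_continuous.
by apply: cvgD; apply: cvgM; [exact: cr|exact: cr|exact: ci|exact: ci].
Qed.

End TrigPoly.

Lemma continuous_sqrtD2 {R : realType} (f g : R -> R) : continuous f -> continuous g ->
  continuous (fun x => Num.sqrt (f x ^+ 2 + g x ^+ 2)).
Proof.
move=> cf cg x; apply: continuous_comp; last exact: sqrt_continuous.
by apply: cvgD; apply: cvgM; [exact: cf|exact: cf|exact: cg|exact: cg].
Qed.

Lemma continuous_excess {R : realType} (f g : R -> R) : continuous f -> continuous g ->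
  continuous (fun x => excess (f x) (g x)).
Proof.
by move=> cf cg x; apply: cvgB; [exact: continuous_sqrtD2|exact: cf].
Qed.

Lemma continuous_l2 {R : realType} n (h : nat -> R -> R) : (forall k, continuous (h k)) ->
  continuous (fun x => l2 n (h^~ x)).
Proof.
move=> ch; elim: n => [|n IH].
  by move=> x; under eq_fun do rewrite /l2 big_ord0; exact: cvg_cst.
by under eq_fun do rewrite l2S; exact: continuous_sqrtD2.
Qed.

Lemma l2_homo {R : realType} (b : nat -> R) : {homo l2^~ b : m n / (m <= n)%N >-> m <= n}.
Proof.
apply: homo_leq => [//|y x z|n]; first exact: le_trans.
by rewrite l2S -[leLHS]ger0_norm ?l2_ge0 // -sqrtr_sqr ler_wsqrtr // lerDl sqr_ge0.
Qed.

Section Main.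
Context {R : realType}.

Lemma gridavg_l2_le (m n N d : nat) (a : nat -> nat -> R[i])
    (T : R -> R) (x : R) :
  (0 < m)%N -> (0 < N)%N -> (0 < d)%N -> (2 * d <= m * N)%N ->
  (forall t, T t = l2 n (fun k => cmod (trig_poly d (a k) t))) ->
  (gridavg N T x <= m%:R * (3 / 2) * mean T)%R.
Proof.
move=> m0 N0 d0 dmN /funext TE.
have L0 : (0 < m * N)%N by rewrite muln_gt0 m0.
have cT : continuous T by rewrite TE; apply: continuous_l2 => k; exact: continuous_cmod_trig_poly.
have pT : circle_continuous T.
  split=> // t; rewrite TE; congr (l2 _ _); apply/funext => k.
  by rewrite -(opprK 1) -[- 1](mulrN1z 1) trig_polyBint.
have bound y : gridavg N T x <= m%:R * (3 / 2) * gridavg (m * N) T y.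
  apply: le_trans (gridavg_refine N m T x _ N0 m0) _; first by move=> t; rewrite TE l2_ge0.
  by rewrite -mulrA TE ler_wpM2l // gridavg_sampling.
rewrite -(mean_gridavg _ _ pT L0) -meanZ; last exact: continuous_gridavg.
rewrite -[leLHS](@mean_cst R); apply: mean_le => //.
  by move=> t; exact: cvg_cst.
by move=> t; apply: cvgM; [exact: cvg_cst|exact: continuous_gridavg].
Qed.

Lemma mean_excess_lag (s n : nat) (h : nat -> R -> R) : (forall k, continuous (h k)) ->
  (\sum_(k < n) mean (fun t => excess (l2 (k - s) (h^~ t)) (h k t)) <=
   s.+1%:R * mean (fun t => l2 n (h^~ t)))%R.
Proof.
move=> ch; have cl m := continuous_l2 m h ch.
apply: le_trans (telescope_lag (fun m => mean (fun t => l2 m (h^~ t))) s n _ _); last 2 first.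
- by move=> k; rewrite -[leLHS](@mean_cst R); apply: mean_le => // [t|t]; [exact: cvg_cst|exact: l2_ge0].
- by move=> i k ik; apply: mean_le => // t; exact: l2_homo.
apply: ler_sum => k _.
have ce : continuous (fun t => excess (l2 (k - s) (h^~ t)) (h k t)).
  exact: continuous_excess.
rewrite lerBrDr -meanD //; apply: mean_le => // [t|t].
  by apply: cvgD; [exact: ce|exact: cl].
rewrite /excess subrK l2S ler_wsqrtr // lerD2r lerXn2r ?nnegrE ?l2_ge0 //.
by apply: l2_homo; lia.
Qed.

Lemma iintT_l2_le (s n : nat) (N : nat -> nat) (h : nat -> R -> R) (l : R) :
  (forall k, circle_continuous (h k)) -> (forall k t, 0 <= h k t) -> (forall k, (0 < N k)%N) ->
  0 <= l ->
  (forall k x, (k < n)%N -> gridavg (N k) (fun t => l2 (k - s) (h^~ t)) x <= l) ->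
  (iintT n (fun w => (l2 n (fun k => gridavg (N k) (h k) (w k)))%:E) <=
   (l + s.+1%:R * mean (fun t => l2 n (h^~ t)))%:E)%E.
Proof.
move=> ph h0 N0 l0 hl; have ch k : continuous (h k) := proj1 (ph k).
have cl m := continuous_l2 m h ch.
have cg k : continuous (fun x => excess l (gridavg (N k) (h k) x)).
  by apply: continuous_excess; [move=> x; exact: cvg_cst|exact: continuous_gridavg].
apply: (@le_trans _ _ (iintT n (fun w =>
    (l + \sum_(k < n) excess l (gridavg (N k) (h k) (w k)))%:E))).
  apply: (proj2 (iintT_le _ _ _ _)) => w _; rewrite !lee_fin l2_ge0; split => //.
  exact: l2_le_excess.
rewrite (iintT_sum n l (fun k x => excess l (gridavg (N k) (h k) x))) // lee_fin lerD2l.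
apply: le_trans (mean_excess_lag s n h ch); apply: ler_sum => k _.
have ce : continuous (fun t => excess (l2 (k - s) (h^~ t)) (h k t)).
  exact: continuous_excess.
rewrite -(mean_gridavg (N k) (fun t => excess (l2 (k - s) (h^~ t)) (h k t))) //; last first.
  split => // t. rewrite /= (proj2 (ph k)); congr (excess (l2 _ _) _).
  by apply/funext => j; exact: (proj2 (ph j)).
apply: mean_le => // [|x]; first exact: continuous_gridavg.
apply: excess_gridavg => [t|t|]; [exact: l2_ge0|exact: h0|exact: hl].
Qed.

Lemma mean_l2_le_L1l2 n (g : nat -> R -> R) : (forall k, continuous (g k)) ->
  ((mean (fun t => l2 n (fun k => g k t)))%:E <= L1l2_norm g)%E.
Proof.
move=> cg; rewrite -intTE; last exact: continuous_l2.
apply: le_intT => x _; rewrite /= lee_fin l2_ge0; split => //.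
have S0 : 0 <= \sum_(k < n) g k x ^+ 2 by rewrite sumr_ge0 // => k _; exact: sqr_ge0.
rewrite /l2 -powR12_sqrt // -poweR_EFin; apply: gt0_ler_poweR.
- by rewrite invr_ge0.
- by rewrite in_itv /= lee_fin S0 leey.
- by rewrite in_itv /= leey andbT; apply: nneseries_ge0 => k _ _; rewrite lee_fin sqr_ge0.
rewrite -sumEFin -(big_mkord xpredT (fun k => ((g k x) ^+ 2)%:E)).
by apply: nneseries_lim_ge => k _ _; rewrite lee_fin sqr_ge0.
Qed.

Lemma eq_L1l2_norm (g h : nat -> R -> R) :
  (forall k t, 0 <= t < 1 -> g k t = h k t) -> L1l2_norm g = L1l2_norm h.
Proof.
move=> gh; apply: eq_integral => t; rewrite inE /= in_itv => t01.
by under eq_eseriesr do rewrite gh //.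
Qed.

Lemma frac_itv (x : R) : 0 <= Defs.frac x < 1.
Proof.
by have := floor_itv x; rewrite intrD /Defs.frac subr_ge0 ltrBlDl.
Qed.

Lemma Estar_gridavg N d (a : nat -> R[i]) (g : R -> R) :
  (forall t, 0 <= t < 1 -> g t = cmod (trig_poly d a t)) ->
  Estar N g = gridavg N (fun t => cmod (trig_poly d a t)).
Proof.
move=> ga; apply/funext => x; congr (_ * _); apply: eq_bigr => j _.
by rewrite /tau ga ?frac_itv // /Defs.frac trig_polyBint.
Qed.

End Main.

(* Sequences are indexed from k = 0 instead of k = 1. *)
Theorem theorem2p11 (R : realType) (alpha beta : R) (s : nat) :
  0 < alpha -> 0 < beta ->
  exists c : R, 0 < c /\
    forall (d N : nat -> nat),
      (forall k, (0 < d k)%N) -> (forall k, (0 < N k)%N) ->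
      (forall k, (1 + alpha) * (d k)%:R <= (d k.+1)%:R) ->
      (forall k, (d k)%:R <= beta * (N (k + s)%N)%:R) ->
      forall f : nat -> R -> R[i],
        (forall k, inH1 (d k) (f k)) ->
        (ind_norm (fun k => Estar (N k) (fun t => cmod (f k t)))
          <= c%:E * L1l2_norm (fun k t => cmod (f k t)))%E.
Proof.
move=> al0 be0; pose m := (Num.bound (2 * beta)).+1.
have mb : 2 * beta <= m%:R.
  rewrite (@le_trans _ _ (Num.bound (2 * beta))%:R) ?ler_nat //.
  by apply/ltW/archi_boundP; rewrite mulr_ge0 // ltW.
pose C : R := m%:R * (3 / 2); have C0 : 0 <= C by rewrite /C mulr_ge0.
exists (C + s.+1%:R); split; first by rewrite ltr_wpDl.
move=> d N d0 N0 dS dN f fH.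
have [a fa] := choice fH.
have dh : {homo d : i k / (i <= k)%N}.
  apply: homo_leq => [//|y x z|k]; first exact: leq_trans.
  rewrite -(ler_nat R); apply: le_trans (dS k).
  by rewrite mulrDl mul1r lerDl mulr_ge0 // ltW.
have fE k (t : R) : 0 <= t < 1 -> f k t = trig_poly (d k) (a k) t.
  move=> t01; rewrite fa //; apply: eq_bigr => j _.
  by rewrite /mode mulrA.
pose h k (t : R) := cmod (trig_poly (d k) (a k) t).
have ph k : circle_continuous (h k).
  split; first exact: continuous_cmod_trig_poly.
  by move=> t; rewrite /h -(opprK 1) -[- 1](mulrN1z 1) trig_polyBint.
have EE k : Estar (N k) (fun t => cmod (f k t)) = gridavg (N k) (h k).
  by apply: Estar_gridavg => t /fE ->.
rewrite (@eq_L1l2_norm R _ h); last by move=> k t /fE ->.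
apply: ge_ereal_sup => _ [n _ <-].
have -> : (fun w : nat -> R => (Num.sqrt (\sum_(k < n) Estar (N k) (fun t => cmod (f k t)) (w k) ^+ 2))%:E)
   = (fun w => (l2 n (fun k => gridavg (N k) (h k) (w k)))%:E).
  by apply/funext => w; congr (Num.sqrt _)%:E; apply: eq_bigr => k _; rewrite EE.
pose T := mean (fun t => l2 n (h^~ t)).
have ch k := proj1 (ph k); have cl k := continuous_l2 k h ch.
have T0 : 0 <= T.
  by rewrite -[leLHS](@mean_cst R); apply: mean_le => // [t|t]; [exact: cvg_cst|exact: l2_ge0].
apply: (@le_trans _ _ ((C + s.+1%:R) * T)%:E); last first.
  by rewrite EFinM lee_wpmul2l ?lee_fin ?addr_ge0 //; exact: mean_l2_le_L1l2.
rewrite mulrDl; apply: iintT_l2_le => // [k t||k x kn]; first exact: cmod_ge0.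
  by rewrite mulr_ge0.
have [ks|sk] := ltnP k s.
  rewrite (_ : (k - s)%N = 0%N); last by lia.
  rewrite /gridavg big1 ?mulr0 ?mulr_ge0 // => j _.
  by rewrite /l2 big_ord0 sqrtr0.
apply: (@le_trans _ _ (C * mean (fun t => l2 (k - s) (h^~ t)))); last first.
  by rewrite ler_wpM2l //; apply: mean_le => // t; apply: l2_homo; lia.
pose b i j := if (j <= d i)%N then a i j else 0.
apply: (gridavg_l2_le m (k - s) (N k) (d (k - s)%N) b) => // [|t]; last first.
  congr Num.sqrt; apply: eq_bigr => i _.
  by rewrite /h /b trig_poly_widen //; apply: dh; apply: ltnW.
have := dN (k - s)%N; rewrite subnK // => dk.
rewrite -(ler_nat R) !natrM; apply: le_trans (_ : 2 * (beta * (N k)%:R) <= _).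
  by rewrite ler_wpM2l.
by rewrite mulrA ler_wpM2r.
Qed.
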